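(* Let $X$ be a compact Hausdorff space and let $A$ be a unital $C(X)$-algebra all of whose fibres $A_x$, $x\in X$, are properly infinite. Then $M_n(A)$ is properly infinite for some natural number $n$.
   Context: A $C(X)$-algebra is a $C^*$-algebra $A$ together with a unital $*$-homomorphism from $C(X)$ into the center of the multiplier algebra of $A$. For $x\in X$, the fibre is $A_x=A/C_0(X\setminus\{x\})A$. A unital $C^*$-algebra is properly infinite if there are mutually orthogonal projections $e,f$ with $e\sim 1\sim f$ (Murray–von Neumann equivalence). *)

(* Defs.v *)
(* MathComp + real_closed (complex numbers R[i]) + MathComp-Analysis (topology). *)
From HB Require Import structures.
From mathcomp Require Import all_boot all_order all_algebra.
From mathcomp Require Import complex.
From mathcomp Require Import all_classical all_reals all_analysis.
Set Implicit Arguments. Unset Strict Implicit. Unset Printing Implicit Defensive.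
Import Order.TTheory GRing.Theory Num.Theory.
Import numFieldNormedType.Exports.
Local Open Scope ring_scope.
Local Open Scope complex_scope.

(* ---------- Unital C*-algebras (over the complex numbers R[i], R : realType) ----------
   A is a unital complex algebra (algType R[i]); [star] is the involution and
   [N] the norm.  We state the C*-algebra axioms explicitly. *)
Definition is_cstar_algebra (R : realType) (A : algType R[i])
    (star : A -> A) (N : A -> R) : Prop :=
  (* involution: conjugate-linear, anti-multiplicative, involutive *)
      (forall x y, star (x + y) = star x + star y) /\
      (forall (c : R[i]) x, star (c *: x) = (c^*)%R *: star x) /\
      (forall x y, star (x * y) = star y * star x) /\
      (forall x, star (star x) = x) /\
      (* norm axioms *)
      (forall x, 0 <= N x) /\
      (forall x, N x = 0 -> x = 0) /\
      (forall x y, N (x + y) <= N x + N y) /\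
      (forall (c : R[i]) x, (N (c *: x))%:C = `|c| * (N x)%:C) /\
      (forall x y, N (x * y) <= N x * N y) /\
      (* C*-identity *)
      (forall x, N (star x * x) = N x ^+ 2) /\
      (* completeness: every N-Cauchy sequence converges *)
      (forall u : nat -> A,
         (forall e : R, 0 < e -> exists M : nat, forall m n : nat,
             (M <= m)%N -> (M <= n)%N -> N (u m - u n) < e) ->
         exists l : A, forall e : R, 0 < e -> exists M : nat, forall n : nat,
             (M <= n)%N -> N (u n - l) < e).

(* ---------- Unital C(X)-algebra structure ----------
   C(X) = continuous functions X -> R[i] (R[i] with its norm topology).  Since A is unital, its multiplier
   algebra is A itself, so the structure map is a unital *-homomorphism
   phi : C(X) -> Z(A).  phi is given as a map on all functions, and the
   axioms are only imposed on continuous functions. *)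
Definition is_CX_structure (R : realType) (X : topologicalType) (A : algType R[i])
    (star : A -> A) (phi : (X -> R[i]) -> A) : Prop :=
  (forall f g : X -> R[i], continuous (f : X -> (R[i] : numFieldType)) -> continuous (g : X -> (R[i] : numFieldType)) ->
         phi (fun x => f x + g x) = phi f + phi g) /\
      (forall (c : R[i]) (f : X -> R[i]), continuous (f : X -> (R[i] : numFieldType)) ->
         phi (fun x => c * f x) = c *: phi f) /\
      (forall f g : X -> R[i], continuous (f : X -> (R[i] : numFieldType)) -> continuous (g : X -> (R[i] : numFieldType)) ->
         phi (fun x => f x * g x) = phi f * phi g) /\
      phi (fun _ => 1) = 1 /\
      (forall f : X -> R[i], continuous (f : X -> (R[i] : numFieldType)) ->
         phi (fun x => (f x)^*%R) = star (phi f)) /\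
      (forall f : X -> R[i], continuous (f : X -> (R[i] : numFieldType)) -> forall a : A, phi f * a = a * phi f).

(* The ideal C_0(X \ {x}) A : the closed linear span of the products
   phi f * a with f continuous, f x = 0, a in A. *)
Definition fibre_ideal (R : realType) (X : topologicalType) (A : algType R[i])
    (N : A -> R) (phi : (X -> R[i]) -> A) (x : X) (b : A) : Prop :=
  forall e : R, 0 < e -> exists (n : nat) (f : 'I_n -> X -> R[i]) (a : 'I_n -> A),
    (forall i, continuous (f i : X -> (R[i] : numFieldType)) /\ f i x = 0) /\
    N (b - \sum_(i < n) phi (f i) * a i) < e.

(* ---------- Proper infiniteness ----------
   For a unital *-ring T, with equality taken up to a relation [eqr]
   (eqr = Leibniz equality for T itself; eqr = congruence modulo an ideal I
   to express proper infiniteness of the quotient T/I, every element of the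
   quotient being the image of an element of T). *)
Definition mvn_equiv_rel (T : pzRingType) (eqr : T -> T -> Prop) (star : T -> T)
    (p q : T) : Prop :=
  exists v : T, eqr (star v * v) p /\ eqr (v * star v) q.

Definition is_projection_rel (T : pzRingType) (eqr : T -> T -> Prop) (star : T -> T)
    (p : T) : Prop :=
  eqr (star p) p /\ eqr (p * p) p.

Definition properly_infinite_rel (T : pzRingType) (eqr : T -> T -> Prop)
    (star : T -> T) : Prop :=
  exists e f : T,
    [/\ is_projection_rel eqr star e, is_projection_rel eqr star f,
        eqr (e * f) 0,
        mvn_equiv_rel eqr star e 1 & mvn_equiv_rel eqr star f 1].

(* Properly infinite unital *-ring *)
Definition properly_infinite (T : pzRingType) (star : T -> T) : Prop :=
  properly_infinite_rel (@eq T) star.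

(* Congruence modulo a (two-sided) ideal I of A *)
Definition congr_mod (T : pzRingType) (I : T -> Prop) (a b : T) : Prop := I (a - b).

(* The fibre A_x = A / C_0(X \ {x}) A is properly infinite *)
Definition fibre_properly_infinite (R : realType) (X : topologicalType)
    (A : algType R[i]) (star : A -> A) (N : A -> R) (phi : (X -> R[i]) -> A)
    (x : X) : Prop :=
  properly_infinite_rel (congr_mod (fibre_ideal N phi x)) star.

(* The involution on M_n(A): (M^* )_{ij} = (M_{ji})^* *)
Definition mxstar (A : pzRingType) (star : A -> A) (n : nat) (M : 'M[A]_n) : 'M[A]_n :=
  \matrix_(i, j) star (M j i).

(* Main.v *)
(** Each fibre contains two isometries with orthogonal ranges.  Rescaling lifts
    of them by inverse square roots gives elements [s], [t] of [A] whose
    isometry relations hold exactly after multiplication by some [phi g] with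
    [g x != 0].  By compactness finitely many such triples [(s_i, t_i, g_i)],
    [i < m], give functions [h_i], multiples of the [g_i], with
    [sum h_i^2 = 1].  The elements [t_i ^+ j * s_i], for all [j], are
    isometries with pairwise orthogonal ranges over the support of [h_i], so
    the matrix with entries [phi h_i * (t_i ^+ j * s_i)], [i < m], [j < 2m],
    is an isometry from [A^2m] to [A^m].  The number of isometries used does
    not affect the cover, which is why [m] can be fixed before [2m]. *)

Require Import Defs.
From HB Require Import structures.
From mathcomp Require Import all_boot all_order all_algebra.
From mathcomp Require Import ring lra.
From mathcomp Require Import complex.
From mathcomp Require Import all_classical all_reals all_analysis.
Import Order.TTheory GRing.Theory Num.Theory.
Import numFieldNormedType.Exports.
Local Open Scope ring_scope.
Local Open Scope complex_scope.

(** * Continuity of real and complex functions *)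

Section ContinuousFunctions.
Context {R : realType} {X : topologicalType}.

Lemma continuous_real_complex (f : X -> R) : continuous f ->
  continuous ((fun x => (f x)%:C) : X -> (R[i] : numFieldType)).
Proof.
move=> cf x; apply/cvgrPdist_lt => e e0.
have eE : (complex.Re e)%:C = e by rewrite RRe_real // gtr0_real.
have e'0 : 0 < complex.Re e by rewrite -ltcR eE.
move/cvgrPdist_lt: (cf x) => /(_ _ e'0); apply: filterS => y.
rewrite -rmorphB normc_def /= expr0n addr0 sqrtr_sqr => h.
by rewrite -eE ltcR.
Qed.

(** The norm on [R[i]] is itself [R[i]]-valued; [complex.Re] brings it back to [R]. *)
Lemma continuous_Re_norm (f : X -> R[i]) :
  continuous (f : X -> (R[i] : numFieldType)) ->
  continuous (fun x => complex.Re `|f x|).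
Proof.
move=> cf x; apply/cvgrPdist_lt => e e0.
have e'0 : 0 < e%:C :> R[i] by rewrite ltcR.
move/cvgrPdist_lt: (cf x) => /(_ _ e'0); apply: filterS => y h.
rewrite -ltcR; apply: le_lt_trans h.
have -> : (`|complex.Re `|f x| - complex.Re `|f y| |)%:C = `| `|f x| - `|f y| | :> R[i].
  rewrite -[in RHS](RRe_real (normr_real (f x))) -[in RHS](RRe_real (normr_real (f y))).
  by rewrite -rmorphB [RHS]normc_def /= expr0n addr0 sqrtr_sqr.
exact: ler_dist_dist.
Qed.

Lemma continuousM_fun (K : numFieldType) (f g : X -> K) :
  continuous f -> continuous g -> continuous (fun x => f x * g x).
Proof. by move=> cf cg x; exact: (continuousM (cf x) (cg x)). Qed.

Lemma continuousD_fun (K : numFieldType) (f g : X -> K) :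
  continuous f -> continuous g -> continuous (fun x => f x + g x).
Proof. by move=> cf cg x; exact: (continuousD (cf x) (cg x)). Qed.

Lemma continuousB_fun (K : numFieldType) (f g : X -> K) :
  continuous f -> continuous g -> continuous (fun x => f x - g x).
Proof. by move=> cf cg x; exact: (continuousB (cf x) (cg x)). Qed.

Lemma continuousV_fun (K : numFieldType) (f : X -> K) :
  (forall x, f x != 0) -> continuous f -> continuous (fun x => (f x)^-1).
Proof. by move=> f0 cf x; exact: (cvgV (f0 x) (cf x)). Qed.

Lemma continuous_sum_fun (K : numFieldType) (I : Type) (r : seq I)
    (f : I -> X -> K) :
  (forall i, continuous (f i)) -> continuous (fun x => \sum_(i <- r) f i x).
Proof.
move=> cf; elim: r => [|i r IH].
  by under eq_fun do rewrite big_nil; move=> x; exact: cvg_cst.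
by under eq_fun do rewrite big_cons; exact: continuousD_fun.
Qed.

Lemma continuous_max_fun (f g : X -> R) : continuous f -> continuous g ->
  continuous (fun x => Num.max (f x) (g x)).
Proof. by move=> cf cg x; exact: (continuous_max (cf x) (cg x)). Qed.

Lemma continuous_min_fun (f g : X -> R) : continuous f -> continuous g ->
  continuous (fun x => Num.min (f x) (g x)).
Proof. by move=> cf cg x; exact: (continuous_min (cf x) (cg x)). Qed.

Lemma continuous_sqrt_fun (f : X -> R) : continuous f ->
  continuous (fun x => Num.sqrt (f x)).
Proof. by move=> cf x; apply: continuous_comp; [exact: cf | exact: sqrt_continuous]. Qed.

End ContinuousFunctions.

(** * Finite covers, and isometries as witnesses of proper infiniteness *)

(** The sets where [G x] is nonzero cover [X], and a sum of squares is positive wherever one term is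
    nonzero. *)
Lemma compact_sum_sqr_gt0 {R : realType} {X : topologicalType} (G : X -> X -> R) :
  compact [set: X] -> (forall x, continuous (G x)) -> (forall x, G x x != 0) ->
  exists r : seq X, forall y, 0 < \sum_(x <- r) G x y * G x y.
Proof.
move=> /compact_near_coveringP cX cG Gx.
(* [F] is the filter of properties shared by all large enough finite lists; the near-covering form
   of compactness then yields one list for all points. *)
pose F : set_system (seq X) :=
  [set Q | exists r0 : seq X, forall r : seq X, {subset r0 <= r} -> Q r]%classic.
have FF : Filter F.
  split.
  - by exists [::].
  - move=> P Q [r1 h1] [r2 h2]; exists (r1 ++ r2) => r h; split.
      by apply: h1 => x xr; apply: h; rewrite mem_cat xr.
    by apply: h2 => x xr; apply: h; rewrite mem_cat xr orbT.
  - by move=> P Q PQ [r0 h0]; exists r0 => r /h0 /PQ.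
pose P (r : seq X) (y : X) := has (fun x => G x y != 0) r.
have [r0 h0] : (\forall r \near F, [set: X] `<=` P r)%classic.
  apply: cX => x _.
  have nz : (\forall y \near x, G x y != 0)%classic.
    exact: cvgr_neq0 (cG x x) (Gx x).
  exists ([set y | G x y != 0]%classic, [set r : seq X | x \in r]%classic).
    split => //=; exists [:: x] => r; apply; exact: mem_head.
  by move=> [y r] /= [Gy xr]; apply/hasP; exists x.
exists r0 => y; have /hasP[x xr Gxy] := h0 r0 (fun _ => id) y I.
rewrite (big_rem x xr) /=; apply: ltr_pwDl; first by rewrite -expr2 exprn_even_gt0.
by apply: sumr_ge0 => z _; rewrite -expr2 sqr_ge0.
Qed.

(** The range projections [a * st a] and [b * st b] serve, with [st a] and [st b] implementing their
    equivalence with 1. *)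
Lemma properly_infinite_isometries (T : pzRingType) (st : T -> T) (a b : T) :
  involutive st -> (forall x y, st (x * y) = st y * st x) ->
  st a * a = 1 -> st b * b = 1 -> st a * b = 0 -> properly_infinite st.
Proof.
move=> stK stM a1 b1 ab; exists (a * st a), (b * st b); split.
- by split; rewrite ?stM ?stK // -mulrA (mulrA (st a)) a1 mul1r.
- by split; rewrite ?stM ?stK // -mulrA (mulrA (st b)) b1 mul1r.
- by rewrite -mulrA (mulrA (st a)) ab mul0r mulr0.
- by exists (st a); rewrite stK.
- by exists (st b); rewrite stK.
Qed.

(** * Norm and involution in a C*-algebra *)

Section CstarAlgebra.
Context {R : realType} {A : algType R[i]} {star : A -> A} {N : A -> R}.
Hypothesis A_cstar : is_cstar_algebra star N.

Lemma starD x y : star (x + y) = star x + star y.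
Proof. by case: A_cstar. Qed.

Lemma starZ (c : R[i]) x : star (c *: x) = (c^*)%R *: star x.
Proof. by case: A_cstar => _ []. Qed.

Lemma starM x y : star (x * y) = star y * star x.
Proof. by case: A_cstar => _ [_ []]. Qed.

Lemma starK x : star (star x) = x.
Proof. by case: A_cstar => _ [_ [_ []]]. Qed.

Lemma N_ge0 x : 0 <= N x.
Proof. by case: A_cstar => _ [_ [_ [_ []]]]. Qed.
Local Hint Resolve N_ge0 : core.

Lemma N_eq0 x : N x = 0 -> x = 0.
Proof. by case: A_cstar => _ [_ [_ [_ [_ [+ _]]]]]; exact. Qed.

Lemma ler_ND x y : N (x + y) <= N x + N y.
Proof. by case: A_cstar => _ [_ [_ [_ [_ [_ []]]]]]. Qed.

Lemma NZ_complex (c : R[i]) x : (N (c *: x))%:C = `|c| * (N x)%:C.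
Proof. by case: A_cstar => _ [_ [_ [_ [_ [_ [_ []]]]]]]. Qed.

Lemma ler_NM x y : N (x * y) <= N x * N y.
Proof. by case: A_cstar => _ [_ [_ [_ [_ [_ [_ [_ []]]]]]]]. Qed.

Lemma N_starM x : N (star x * x) = N x ^+ 2.
Proof. by case: A_cstar => _ [_ [_ [_ [_ [_ [_ [_ [_ []]]]]]]]]. Qed.

Lemma N_complete (u : nat -> A) :
  (forall e : R, 0 < e -> exists M : nat, forall m n : nat,
     (M <= m)%N -> (M <= n)%N -> N (u m - u n) < e) ->
  exists l : A, forall e : R, 0 < e -> exists M : nat, forall n : nat,
     (M <= n)%N -> N (u n - l) < e.
Proof.
by case: A_cstar => _ [_ [_ [_ [_ [_ [_ [_ [_ [_ +]]]]]]]]]; exact.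
Qed.

Lemma scale2C (x : A) : (2 : R)%:C *: x = x + x.
Proof.
by rewrite (_ : 2 = 1 + 1 :> R) ?rmorphD ?rmorph1 ?scalerDl ?scale1r //; lra.
Qed.

Lemma star0 : star 0 = 0.
Proof. by apply: (addrI (star 0)); rewrite -starD !addr0. Qed.

Lemma starN x : star (- x) = - star x.
Proof. by apply/eqP; rewrite -addr_eq0 -starD addNr star0. Qed.

Lemma starB x y : star (x - y) = star x - star y.
Proof. by rewrite starD starN. Qed.

Lemma star1 : star 1 = 1.
Proof. by have := starM (star 1) 1; rewrite mulr1 starK mulr1. Qed.

Lemma NZ (c : R) x : N (c%:C *: x) = `|c| * N x.
Proof.
apply: (fmorph_inj (real_complex R)).
by rewrite [LHS]NZ_complex [RHS]rmorphM /= normc_def /= expr0n addr0 sqrtr_sqr.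
Qed.

Lemma NN x : N (- x) = N x.
Proof.
have -> : - x = (-1 : R)%:C *: x by rewrite rmorphN1 scaleN1r.
by rewrite NZ normrN1 mul1r.
Qed.

Lemma N0 : N 0 = 0.
Proof. by rewrite -(scale0r (0 : A)) (NZ 0) normr0 mul0r. Qed.

Lemma N1 : N 1 = 1.
Proof.
have h : N 1 = N 1 ^+ 2 by rewrite -N_starM star1 mulr1.
have n0 : N 1 != 0 by apply/eqP => /N_eq0/eqP; rewrite oner_eq0.
by apply: (mulfI n0); rewrite mulr1 -expr2 -h.
Qed.

Lemma N_unitary_le u : star u * u = 1 -> N u <= 1.
Proof.
move=> h; rewrite -(@ler_pXn2r _ 2) ?nnegrE ?N_ge0 // expr1n.
by rewrite -N_starM h N1.
Qed.

Lemma N_star x : N (star x) = N x.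
Proof.
suff le y : N y <= N (star y).
  by apply/eqP; rewrite eq_le le andbT -{2}(starK x) le.
have [->|y0] := eqVneq y 0; first by rewrite star0.
have Ny0 : 0 < N y by rewrite lt_def N_ge0 andbT; apply: contra y0 => /eqP/N_eq0/eqP.
by rewrite -(ler_pM2r Ny0) -expr2 -N_starM ler_NM.
Qed.

Lemma ler_NB x y : N (x - y) <= N x + N y.
Proof. by rewrite (le_trans (ler_ND _ _)) // NN. Qed.

Lemma ler_N_sum (I : Type) (r : seq I) (f : I -> A) :
  N (\sum_(i <- r) f i) <= \sum_(i <- r) N (f i).
Proof.
elim: r => [|i r IH]; first by rewrite !big_nil N0.
by rewrite !big_cons (le_trans (ler_ND _ _)) // lerD2l.
Qed.

(** * Inverse square roots by iteration *)

(* The fixed points of [w |-> (- w ^+ 2 + (1 + w) * y * (1 + w)) / 2] are the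
   [w] with [(1 + w) * (1 - y) * (1 + w) = 1]. *)
Definition inv_sqrt_step (y w : A) : A :=
  (2^-1 : R)%:C *: (- (w * w) + (1 + w) * y * (1 + w)).

(** The triangle inequality gives (1/4 + 9/32)/2 = 17/64. *)
Lemma inv_sqrt_step_ball y w : N y <= 8^-1 -> N w <= 2^-1 ->
  N (inv_sqrt_step y w) <= 2^-1.
Proof.
move=> hy hw.
have h1w : N (1 + w) <= 3 / 2.
  by have := ler_ND 1 w; rewrite N1; move: hw; set a := N w; lra.
have hww : N (w * w) <= 1 / 4.
  apply: le_trans (ler_NM _ _) _.
  by have := ler_pM (N_ge0 w) (N_ge0 w) hw hw; lra.
have hyw : N ((1 + w) * y * (1 + w)) <= 3 / 2 * (8^-1) * (3 / 2).
  apply: le_trans (ler_NM _ _) _; apply: ler_pM; rewrite ?N_ge0 //.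
  by apply: le_trans (ler_NM _ _) _; apply: ler_pM; rewrite ?N_ge0.
rewrite NZ ger0_norm ?invr_ge0 //.
have := ler_ND (- (w * w)) ((1 + w) * y * (1 + w)); rewrite NN.
by move: hww hyw; lra.
Qed.

(** The splitting [w * w - z * z = w * d + d * z] and its analogue for [(1 + w) * y * (1 + w)] need
    no commutativity. The constant obtained is (1 + 3/8)/2 = 11/16, rounded up to 3/4. *)
Lemma inv_sqrt_step_contract y w z : N y <= 8^-1 -> N w <= 2^-1 -> N z <= 2^-1 ->
  N (inv_sqrt_step y w - inv_sqrt_step y z) <= 3 / 4 * N (w - z).
Proof.
move=> hy hw hz; set d := w - z.
have -> : inv_sqrt_step y w - inv_sqrt_step y z =
    (2^-1 : R)%:C *: (- (w * d + d * z) + ((1 + w) * y * d + d * y * (1 + z))).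
  rewrite /inv_sqrt_step -scalerBr; congr (_ *: _).
  have -> : w * d + d * z = w * w - z * z by rewrite mulrBr mulrBl addrA subrK.
  have -> : (1 + w) * y * d + d * y * (1 + z) =
      (1 + w) * y * (1 + w) - (1 + z) * y * (1 + z).
    have -> : d = (1 + w) - (1 + z) by rewrite opprD addrACA subrr add0r.
    by rewrite mulrBr !mulrBl addrA subrK.
  by rewrite opprD opprK addrACA opprB [in RHS](addrC (z * z)).
have h1 v : N v <= 2^-1 -> N (1 + v) <= 3 / 2.
  by have := ler_ND 1 v; rewrite N1; set a := N v; lra.
have hd := N_ge0 d.
have e1 : N (w * d) <= 2^-1 * N d.
  by apply: le_trans (ler_NM _ _) _; rewrite ler_wpM2r.
have e2 : N (d * z) <= N d * 2^-1.
  by apply: le_trans (ler_NM _ _) _; rewrite ler_wpM2l.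
have e3 : N ((1 + w) * y * d) <= 3 / 2 * (8^-1) * N d.
  apply: le_trans (ler_NM _ _) _; rewrite ler_wpM2r //.
  by apply: le_trans (ler_NM _ _) _; apply: ler_pM; rewrite ?N_ge0 ?h1.
have e4 : N (d * y * (1 + z)) <= N d * (8^-1) * (3 / 2).
  apply: le_trans (ler_NM _ _) _; apply: ler_pM; rewrite ?N_ge0 ?h1 //.
  by apply: le_trans (ler_NM _ _) _; rewrite ler_wpM2l.
rewrite NZ ger0_norm ?invr_ge0 //.
have := ler_ND (- (w * d + d * z)) ((1 + w) * y * d + d * y * (1 + z)).
have := ler_ND (w * d) (d * z).
have := ler_ND ((1 + w) * y * d) (d * y * (1 + z)).
by rewrite NN; move: e1 e2 e3 e4; lra.
Qed.

(** [q] stands for the inverse square root of [1 - y], found without functional calculus: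
    [q = 1 + l], with [l] the limit of the iterates of the contraction [inv_sqrt_step y] from 0.
    Self-adjointness passes from the iterates to [l]. *)
Lemma inv_sqrt_exists y : star y = y -> N y <= 8^-1 ->
  exists q, star q = q /\ q * (1 - y) * q = 1.
Proof.
move=> sy hy; pose F := inv_sqrt_step y; pose u n := iter n F 0.
have ub n : N (u n) <= 2^-1.
  elim: n => [|n IH]; first by rewrite /u /= N0 invr_ge0.
  by rewrite /u iterS; exact: inv_sqrt_step_ball.
have us n : star (u n) = u n.
  elim: n => [|n IH]; first exact: star0.
  rewrite /u iterS -/(u n) /F /inv_sqrt_step starZ starD starN !starM starD star1 IH sy.
  by rewrite mulrA; congr (_ *: _); exact: conjc_real.
(* Each contraction lowers both indices by one, down to [N (u p) <= 1/2 <= 1]. *)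
have ud n p : N (u (n + p)%N - u n) <= (3 / 4) ^+ n.
  elim: n => [|n IH].
    rewrite expr0 /= subr0 (le_trans (ub _)) //; lra.
  rewrite addSn /u !iterS -!/(u _) exprS.
  apply: le_trans (inv_sqrt_step_contract _ _ _ hy (ub _) (ub _)) _.
  by rewrite ler_pM2l //; lra.
have geo e : 0 < e -> exists M : nat, forall n, (M <= n)%N -> (3 / 4 : R) ^+ n < e.
  move=> e0; have r1 : `|3 / 4 : R| < 1 by rewrite ger0_norm; lra.
  have /cvgrPdist_lt /(_ _ e0) [M _ hM] := cvg_expr r1.
  exists M => n /hM /=; rewrite sub0r normrN.
  by apply: le_lt_trans; exact: ler_norm.
have [l hl] : exists l, forall e, 0 < e -> exists M : nat, forall n, (M <= n)%N -> N (u n - l) < e.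
  apply: N_complete => e e0; have [M hM] := geo _ e0; exists M.
  suff H m n : (M <= n)%N -> (n <= m)%N -> N (u m - u n) < e.
    move=> m n Mm Mn; have [le|/ltnW le] := leqP n m; first exact: H.
    by rewrite -NN opprB; exact: H.
  move=> Mn nm; rewrite -(subnKC nm); apply: le_lt_trans (ud _ _) _; exact: hM.
have N_small z : (forall e : R, 0 < e -> N z <= e) -> z = 0.
  move=> h; apply: N_eq0; apply/eqP; rewrite eq_le N_ge0 andbT.
  by apply/ler_addgt0Pr => e e0; rewrite add0r h.
have lb : N l <= 2^-1.
  apply/ler_addgt0Pr => e e0; have [M hM] := hl _ e0.
  have := ler_NB (u M) (u M - l); rewrite opprB addrC subrK.
  by have := hM _ (leqnn M); have := ub M; lra.
have ls : star l = l.
  apply/eqP; rewrite -subr_eq0; apply/eqP/N_small => e e0.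
  have e2 : 0 < e / 2 by lra.
  have [M hM] := hl _ e2; have := hM _ (leqnn M) => hM1.
  have -> : star l - l = (u M - l) - star (u M - l).
    by rewrite starB us opprB [RHS]addrC addrA subrK.
  by have := ler_NB (u M - l) (star (u M - l)); rewrite N_star; lra.
have lF : F l = l.
  apply/eqP; rewrite -subr_eq0; apply/eqP/N_small => e e0.
  have e2 : 0 < e / 2 by lra.
  have [M hM] := hl _ e2; have h1 := hM _ (leqnn M); have h2 := hM _ (leqnSn M).
  have h3 := inv_sqrt_step_contract _ _ _ hy (ub M) lb.
  (* Since [u M.+1] is [F (u M)], the first difference is small by convergence and the second by
     contraction. *)
  have -> : F l - l = (u M.+1 - l) - (F (u M) - F l).
    by rewrite /u iterS -/(u M) opprB [RHS]addrC addrA subrK.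
  have := ler_NB (u M.+1 - l) (F (u M) - F l).
  by have := N_ge0 (u M - l); move: h3; rewrite -/F; lra.
exists (1 + l); split; first by rewrite starD star1 ls.
(* Doubling the fixed-point equation shows that [(1 + l) * y * (1 + l)] is [2 l + l * l]; subtracted
   from the square of [1 + l], it leaves 1. *)
have : (2 : R)%:C *: F l = (2 : R)%:C *: l by rewrite lF.
rewrite /F /inv_sqrt_step scalerA -rmorphM mulfV ?pnatr_eq0 // rmorph1 scale1r => h.
rewrite mulrBr mulr1 mulrBl.
have -> : (1 + l) * y * (1 + l) = (2 : R)%:C *: l + l * l by rewrite -h addrAC addNr add0r.
rewrite scale2C.
by rewrite mulrDl mul1r mulrDr mulr1 -(addrA 1) (addrA l) addrK.
Qed.

(** * The structure map and its contractivity *)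

Context {X : topologicalType} {phi : (X -> R[i]) -> A}.
Hypothesis A_CX : is_CX_structure star phi.

Local Notation cts f := (continuous (f : X -> (R[i] : numFieldType))).

Lemma phiD (f g : X -> R[i]) : cts f -> cts g -> phi (fun x => f x + g x) = phi f + phi g.
Proof. by case: A_CX => + _; apply. Qed.

Lemma phiZ (c : R[i]) (f : X -> R[i]) : cts f -> phi (fun x => c * f x) = c *: phi f.
Proof. by case: A_CX => _ [+ _]; apply. Qed.

Lemma phiM (f g : X -> R[i]) : cts f -> cts g -> phi (fun x => f x * g x) = phi f * phi g.
Proof. by case: A_CX => _ [_ [+ _]]; apply. Qed.

Lemma phi1 : phi (fun=> 1) = 1.
Proof. by case: A_CX => _ [_ [_ []]]. Qed.

Lemma phi_star (f : X -> R[i]) : cts f -> phi (fun x => (f x)^*%R) = star (phi f).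
Proof. by case: A_CX => _ [_ [_ [_ [+ _]]]]; apply. Qed.

Lemma phi_central (f : X -> R[i]) (a : A) : cts f -> phi f * a = a * phi f.
Proof. by case: A_CX => _ [_ [_ [_ [_ +]]]] cf; apply. Qed.

Lemma continuousM_complex (f g : X -> R[i]) : cts f -> cts g ->
  cts (fun x => f x * g x).
Proof. exact: continuousM_fun. Qed.

Lemma continuous_conj (f : X -> R[i]) : cts f -> cts (fun x => (f x)^*%R).
Proof.
move=> cf x; apply/cvgrPdist_lt => e e0.
move/cvgrPdist_lt: (cf x) => /(_ _ e0); apply: filterS => y.
by rewrite -rmorphB norm_conjC.
Qed.

Lemma Re_norm_ge0 (z : R[i]) : 0 <= complex.Re `|z|.
Proof. by rewrite normc_def /= sqrtr_ge0. Qed.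

Lemma Re_normZ (c : R) (z : R[i]) :
  complex.Re `|c%:C * z| = `|c| * complex.Re `|z|.
Proof.
by rewrite normrM !normc_def /= expr0n addr0 sqrtr_sqr mul0r subr0.
Qed.

Definition phi_real (f : X -> R) : A := phi (fun x => (f x)%:C).

Lemma phi_realD (f g : X -> R) : continuous f -> continuous g ->
  phi_real (fun x => f x + g x) = phi_real f + phi_real g.
Proof.
move=> cf cg; rewrite /phi_real -phiD; try exact: continuous_real_complex.
by congr phi; apply/funext => x; rewrite rmorphD.
Qed.

Lemma phi_realM (f g : X -> R) : continuous f -> continuous g ->
  phi_real (fun x => f x * g x) = phi_real f * phi_real g.
Proof.
move=> cf cg; rewrite /phi_real -phiM; try exact: continuous_real_complex.
by congr phi; apply/funext => x; rewrite rmorphM.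
Qed.

Lemma phi_real1 : phi_real (fun=> 1) = 1.
Proof. exact: phi1. Qed.

Lemma phi_real0 : phi_real (fun=> 0) = 0.
Proof.
have c0 : continuous (cst 0 : X -> R) by move=> x; exact: cvg_cst.
have := phi_realD _ _ c0 c0; under eq_fun do rewrite addr0.
by move/eqP; rewrite -subr_eq0 opprD addrA subrr sub0r oppr_eq0 => /eqP.
Qed.

Lemma phi_real_star (f : X -> R) : continuous f -> star (phi_real f) = phi_real f.
Proof.
move=> cf; rewrite /phi_real -phi_star; last exact: continuous_real_complex.
by congr phi; apply/funext => x; exact: conjc_real.
Qed.

Lemma phi_real_central (f : X -> R) (a : A) : continuous f -> phi_real f * a = a * phi_real f.
Proof. by move=> cf; apply/phi_central/continuous_real_complex. Qed.

Lemma phi_real_sum (I : Type) (r : seq I) (f : I -> X -> R) :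
  (forall i, continuous (f i)) ->
  phi_real (fun x => \sum_(i <- r) f i x) = \sum_(i <- r) phi_real (f i).
Proof.
move=> cf; elim: r => [|i r IH].
  by rewrite big_nil -phi_real0; congr phi_real; apply/funext => x; rewrite big_nil.
rewrite big_cons -IH -phi_realD //; last exact: continuous_sum_fun.
by congr phi_real; apply/funext => x; rewrite big_cons.
Qed.

(** No spectral theory enters: with [F] the squared modulus of [f], the C*-identity gives
    [N (phi f) ^+ 2 = N (phi_real F)], and [phi_real F] is the real part of a unitary. *)
Lemma phi_contractive (f : X -> R[i]) : cts f -> (forall x, complex.Re `|f x| <= 1) ->
  N (phi f) <= 1.
Proof.
move=> cf f1.
(* [g] is chosen so that [F + i g] has modulus 1 at every point. *)
pose F x := complex.Re `|f x| ^+ 2; pose g x := Num.sqrt (1 - F x ^+ 2).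
have fF x : (f x)^*%R * f x = (F x)%:C.
  by rewrite mulrC -normCK -(RRe_real (normr_real (f x))) -rmorphXn.
have F0 x : 0 <= F x by exact: sqr_ge0.
have F1 x : F x <= 1.
  by rewrite /F expr_le1 // ?f1 // Re_norm_ge0.
have cF : continuous F.
  by apply: continuousM_fun; exact: continuous_Re_norm.
have cg : continuous g.
  apply: continuous_sqrt_fun; apply: continuousB_fun; first by move=> x; exact: cvg_cst.
  exact: continuousM_fun.
have gF x : F x * F x + g x * g x = 1.
  rewrite -!expr2 sqr_sqrtr; first by rewrite addrC subrK.
  by rewrite subr_ge0 expr_le1.
have FgE : phi_real F * phi_real F + phi_real g * phi_real g = 1.
  rewrite -!phi_realM // -phi_realD; try exact: continuousM_fun.
  by rewrite -phi_real1; congr phi_real; apply/funext.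
have FgC : phi_real F * phi_real g = phi_real g * phi_real F by exact: phi_real_central.
set a := phi_real F in FgE FgC *; set b := phi_real g in FgE FgC *.
have aS : star a = a by exact: phi_real_star.
have bS : star b = b by exact: phi_real_star.
(* [a ^+ 2 + b ^+ 2 = 1] makes [a + 'i *: b] unitary. *)
have Nab : N (a + 'i *: b) <= 1.
  apply: N_unitary_le; rewrite starD starZ aS bS.
  have -> : ('i^*)%R = - 'i :> R[i] by exact: conjCi.
  rewrite mulrDl !mulrDr -!scalerAl -!scalerAr scalerA -FgC scaleNr.
  by rewrite mulNr -(expr2 'i) sqrCi opprK scale1r addrA addrK.
have Na : N a <= 1.
  have -> : a = (2^-1 : R)%:C *: ((a + 'i *: b) + star (a + 'i *: b)).
    rewrite starD starZ aS bS (_ : ('i^*)%R = - 'i :> R[i]); last exact: conjCi.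
    rewrite scaleNr addrACA subrr addr0 -scale2C scalerA.
    by rewrite -rmorphM mulVf ?pnatr_eq0 // scale1r.
  rewrite NZ ger0_norm ?invr_ge0 //.
  by have := ler_ND (a + 'i *: b) (star (a + 'i *: b)); rewrite N_star; lra.
rewrite -(@ler_pXn2r _ 2) ?nnegrE ?N_ge0 // expr1n -N_starM.
have -> : star (phi f) * phi f = a.
  rewrite -(phi_star _ cf) -(phiM _ _ (continuous_conj f cf) cf).
  by congr phi; apply/funext => x; exact: fF.
exact: Na.
Qed.

Lemma phi_norm_le (f : X -> R[i]) (c : R) :
  cts f -> 0 < c -> (forall x, complex.Re `|f x| <= c) -> N (phi f) <= c.
Proof.
move=> cf c0 fc; pose k : X -> R[i] := fun=> (c^-1)%:C.
have ck : cts k by move=> x; exact: cvg_cst.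
have c'0 : 0 <= c^-1 by rewrite invr_ge0 ltW.
suff : N (phi (fun x => k x * f x)) <= 1.
  rewrite (phiZ (c^-1)%:C f cf) NZ ger0_norm //.
  by rewrite mulrC ler_pdivrMr // mul1r.
apply: phi_contractive => [|x]; first exact: (continuousM_complex k f ck cf).
by rewrite Re_normZ ger0_norm // mulrC ler_pdivrMr // mul1r.
Qed.

Lemma phi_real_contractive (f : X -> R) : continuous f -> (forall x, 0 <= f x <= 1) ->
  N (phi_real f) <= 1.
Proof.
move=> cf f1; apply: phi_contractive => [|x]; first exact: continuous_real_complex.
have /andP[f0 f1'] := f1 x.
by rewrite normc_def /= expr0n addr0 sqrtr_sqr ger0_norm.
Qed.

(** * Localization near a point *)

(* Stands in for membership in the fibre ideal; the condition on [g] says that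
   [h] is [1] near [x]. *)
Definition small_near (x : X) (b : A) : Prop :=
  forall e : R, 0 < e -> exists h g : X -> R,
    [/\ continuous h, continuous g, forall y, 0 <= h y <= 1,
        g x != 0 & forall y, g y * h y = g y] /\ N (phi_real h * b) <= e.

(** Up to [e / 2], [b] is a finite sum of terms [phi (f i) * a i]. All [f i] are small near [x], so
    a cutoff supported there makes the sum small. *)
Lemma fibre_ideal_small_near (x : X) (b : A) :
  fibre_ideal N phi x b -> small_near x b.
Proof.
move=> bI e e0.
have e2 : 0 < e / 2 by lra.
have [n [f [a [fP bE]]]] := bI _ e2.
have cf i : cts (f i) by case: (fP i).
pose C := 1 + \sum_(i < n) N (a i).
have C0 : 0 < C by apply: ltr_wpDr => //; apply: sumr_ge0.
(* This makes [2 * d * C = e / 2], where [2 * d] will bound each [f i] on the support of the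
   cutoff. *)
pose d := e / (4 * C).
have d0 : 0 < d by rewrite divr_gt0 // mulr_gt0.
pose F y := \sum_(i < n) complex.Re `|f i y|.
have cF : continuous F.
  by apply: continuous_sum_fun => i; exact: continuous_Re_norm.
have Fx : F x = 0.
  by rewrite /F big1 // => i _; case: (fP i) => _ ->; rewrite normr0.
have fF i y : complex.Re `|f i y| <= F y.
  rewrite /F (bigD1 i) //= lerDl; apply: sumr_ge0 => j _; exact: Re_norm_ge0.
have cc (c : R) : continuous (cst c : X -> R) by move=> y; exact: cvg_cst.
have cFd : continuous (fun y => F y * d^-1) by apply: continuousM_fun => //; exact: cc.
(* [h] is 1 where [F <= d] and 0 where [F >= 2 * d]; [g] is nonzero only where [F < d], hence where
   [h] is 1. *)
pose h y := Num.max 0 (Num.min 1 (2 - F y * d^-1)).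
pose g y := Num.max 0 (1 - F y * d^-1).
have ch : continuous h.
  apply: continuous_max_fun; first exact: cc.
  apply: continuous_min_fun; first exact: cc.
  by apply: continuousB_fun => //; exact: cc.
have cg : continuous g.
  apply: continuous_max_fun; first exact: cc.
  by apply: continuousB_fun => //; exact: cc.
have h01 y : 0 <= h y <= 1.
  by rewrite /h le_max lexx /= ge_max ler01 /= ge_min lexx.
exists h, g; split.
  split=> //; first by rewrite /g Fx mul0r subr0 max_r ?ler01 // oner_eq0.
  move=> y; rewrite /g /h; set t := F y * d^-1.
  have [t1|t1] := leP t 1; last by rewrite max_l ?mul0r //; lra.
  by rewrite (@min_l _ _ 1) ?(@max_r _ _ 0 1) ?mulr1 ?ler01 //; lra.
(* Either [F y <= 2 * d], which bounds [f i y], or [h y = 0]. *)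
have hf i y : complex.Re `|(h y)%:C * f i y| <= 2 * d.
  rewrite Re_normZ; have /andP[h0 h1] := h01 y; rewrite ger0_norm //.
  have r0 := Re_norm_ge0 (f i y); have := fF i y.
  set r := complex.Re _ in r0 * => rF.
  have [Fd|Fd] := leP (F y) (2 * d); first by nra.
  have -> : h y = 0.
    rewrite /h max_l // ge_min; apply/orP; right.
    by rewrite subr_le0 ler_pdivlMr // ltW.
  by rewrite mul0r mulr_ge0 // ltW.
have hfa i : N (phi_real h * (phi (f i) * a i)) <= 2 * d * N (a i).
  rewrite mulrA; apply: le_trans (ler_NM _ _) _; apply: ler_wpM2r => //.
  rewrite -(phiM _ _ (continuous_real_complex _ ch) (cf i)).
  apply: phi_norm_le; [|by rewrite mulr_gt0|exact: hf].
  exact: (continuousM_complex _ _ (continuous_real_complex _ ch) (cf i)).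
have -> : b = (b - \sum_(i < n) phi (f i) * a i) + \sum_(i < n) phi (f i) * a i.
  by rewrite subrK.
rewrite mulrDr mulr_sumr; apply: le_trans (ler_ND _ _) _.
have -> : e = e / 2 + 2 * d * C by rewrite /d; field; rewrite gt_eqF.
apply: lerD.
  apply: le_trans (ler_NM _ _) _; have := phi_real_contractive _ ch h01.
  by have := N_ge0 (b - \sum_(i < n) phi (f i) * a i); move: bE; set r := N (b - _); nra.
apply: le_trans (ler_N_sum _ _ _) _.
apply: (@le_trans _ _ (\sum_(i < n) 2 * d * N (a i))); first exact: ler_sum.
rewrite -mulr_sumr; apply: ler_wpM2l; first by rewrite mulr_ge0 // ltW.
by rewrite /C ler_wpDl.
Qed.

(** A product of cutoffs is a cutoff, and their images under [phi_real] are contractions, so the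
    estimates survive. With the next lemmas, [small_near x] behaves as a two-sided ideal, and
    computations modulo it imitate those in the fibre. *)
Lemma small_nearD x b c : small_near x b -> small_near x c -> small_near x (b + c).
Proof.
move=> hb hc e e0; have e2 : 0 < e / 2 by lra.
have [h1 [g1 [[ch1 cg1 h101 g1x gh1] N1']]] := hb _ e2.
have [h2 [g2 [[ch2 cg2 h201 g2x gh2] N2']]] := hc _ e2.
exists (fun y => h1 y * h2 y), (fun y => g1 y * g2 y); split.
  split; try exact: continuousM_fun.
  - move=> y; have /andP[? ?] := h101 y; have /andP[? ?] := h201 y.
    by rewrite mulr_ge0 //= mulr_ile1.
  - by rewrite mulf_neq0.
  - by move=> y; rewrite mulrACA gh1 gh2.
rewrite phi_realM // mulrDr; apply: le_trans (ler_ND _ _) _.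
have -> : e = e / 2 + e / 2 by lra.
apply: lerD.
  rewrite (phi_real_central h1) // -mulrA.
  apply: le_trans (ler_NM _ _) _; have := phi_real_contractive _ ch2 h201.
  by have := N_ge0 (phi_real h2); have := N_ge0 (phi_real h1 * b); nra.
rewrite -mulrA; apply: le_trans (ler_NM _ _) _; have := phi_real_contractive _ ch1 h101.
by have := N_ge0 (phi_real h1); have := N_ge0 (phi_real h2 * c); nra.
Qed.

Lemma small_nearMr x b c : small_near x b -> small_near x (b * c).
Proof.
move=> hb e e0; have Nc := N_ge0 c.
(* [1 + N c] avoids division by zero. *)
have e2 : 0 < e / (1 + N c) by rewrite divr_gt0 //; lra.
have [h [g [H Nh]]] := hb _ e2; exists h, g; split=> //.
rewrite mulrA; apply: le_trans (ler_NM _ _) _.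
apply: (@le_trans _ _ (e / (1 + N c) * N c)); first exact: ler_wpM2r.
by rewrite mulrAC ler_pdivrMr; nra.
Qed.

Lemma small_nearMl x b c : small_near x b -> small_near x (c * b).
Proof.
move=> hb e e0; have Nc := N_ge0 c.
have e2 : 0 < e / (1 + N c) by rewrite divr_gt0 //; lra.
have [h [g [H Nh]]] := hb _ e2; exists h, g; split=> //.
case: H => ch _ _ _ _.
rewrite mulrA phi_real_central // -mulrA; apply: le_trans (ler_NM _ _) _.
apply: (@le_trans _ _ (N c * (e / (1 + N c)))); first exact: ler_wpM2l.
by rewrite mulrA ler_pdivrMr; nra.
Qed.

Lemma small_nearN x b : small_near x b -> small_near x (- b).
Proof. by move=> hb; rewrite -mulN1r; exact: small_nearMl. Qed.

Lemma small_nearB x b c : small_near x b -> small_near x c -> small_near x (b - c).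
Proof. by move=> hb hc; apply: small_nearD => //; exact: small_nearN. Qed.

(** * Lifting isometries from a fibre to a neighbourhood *)

(** The cutoff makes the defect [star b * b - 1] globally small, so
    [1 + phi_real h * (star b * b - 1)] has an inverse square root [q]. Where [g] is nonzero, [h] is
    1 and this element agrees with [star b * b]. *)
Lemma local_isometry x b : small_near x (star b * b - 1) ->
  exists q (g : X -> R), [/\ continuous g, g x != 0 &
    phi_real g * (star (b * q) * (b * q)) = phi_real g].
Proof.
have e0 : 0 < 8^-1 :> R by rewrite invr_gt0.
move=> /(_ _ e0) [h [g [[ch cg h01 gx gh] Nh]]].
pose y := - (phi_real h * (star b * b - 1)).
have sy : star y = y.
  rewrite /y starN starM starB starM starK star1 phi_real_star //.
  by rewrite -phi_real_central.
have Ny : N y <= 8^-1 by rewrite NN.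
have [q [sq qE]] := inv_sqrt_exists _ sy Ny.
exists q, g; split=> //.
have gE : phi_real g * (1 - y) = phi_real g * (star b * b).
  rewrite /y opprK mulrDr mulr1 mulrA -phi_realM //.
  have -> : (fun y => g y * h y) = g by apply/funext.
  by rewrite mulrBr mulr1 addrC subrK.
have gq z : phi_real g * (q * z * q) = q * (phi_real g * z) * q.
  by rewrite !mulrA (phi_real_central g q).
have -> : star (b * q) * (b * q) = q * (star b * b) * q by rewrite starM sq !mulrA.
by rewrite gq -gE -gq qE mulr1.
Qed.

(** In the fibre, [star v] and [star w] are isometries with ranges [e] and [f]. The first is
    corrected to an exact local isometry [s]; the second is made exactly orthogonal to [s], then
    corrected by a right factor, which keeps the orthogonality. *)
Lemma local_isometry_pair x : fibre_properly_infinite star N phi x ->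
  exists (s t : A) (g : X -> R), [/\ continuous g, g x != 0,
    phi_real g * (star s * s) = phi_real g,
    phi_real g * (star t * t) = phi_real g & phi_real g * (star s * t) = 0].
Proof.
move=> [e [f [_ _ ef [v [ve v1]] [w [wf w1]]]]].
move: ef ve v1 wf w1; rewrite /congr_mod subr0.
move=> /fibre_ideal_small_near ef /fibre_ideal_small_near ve
  /fibre_ideal_small_near v1 /fibre_ideal_small_near wf /fibre_ideal_small_near w1.
have [q1 [g1 [cg1 g1x sE]]] : exists q (g : X -> R), [/\ continuous g, g x != 0 &
    phi_real g * (star (star v * q) * (star v * q)) = phi_real g].
  by apply: local_isometry; rewrite starK.
set s := star v * q1 in sE; pose d := star s * star w.
(* Modulo [small_near x], [v * star w] equals [v * (star v * v) * (star w * w) * star w], hence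
   [v * e * f * star w], which vanishes. *)
have vw : small_near x (v * star w).
  have SP : small_near x ((star v * v) * (star w * w)).
    have -> : (star v * v) * (star w * w) =
        (star v * v - e) * (star w * w) + (e * (star w * w - f) + e * f).
      by rewrite -mulrDr subrK -mulrDl subrK.
    apply: small_nearD; first exact: small_nearMr.
    by apply: small_nearD => //; exact: small_nearMl.
  set u := v * star w.
  (* Inserting [v * star v] to the left of [u] and [w * star w] to its right costs the two
     subtracted terms. *)
  have -> : u = v * ((star v * v) * (star w * w)) * star w - (v * star v - 1) * u
      - (v * star v) * u * (w * star w - 1).
    have -> : v * ((star v * v) * (star w * w)) * star w = (v * star v) * u * (w * star w).
      by rewrite /u !mulrA.
    rewrite mulrBl mul1r [X in _ = _ - X]mulrBr mulr1 !opprB.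
    by rewrite -addrA (addrA (u - _)) subrK addrC subrK.
  apply: small_nearB; last exact: small_nearMl.
  apply: small_nearB; last exact: small_nearMr.
  by apply: small_nearMr; exact: small_nearMl.
have dJ : small_near x d.
  by rewrite /d /s starM starK -mulrA; exact: small_nearMl.
(* Gram-Schmidt: [s * d] is the component of [star w] along the range of [s]. As [d] is small near
   [x], [t1] remains nearly isometric. *)
pose t1 := star w - s * d.
have t1J : small_near x (star t1 * t1 - 1).
  have -> : star t1 * t1 - 1 =
      (w * star w - 1) - (w * s) * d - (star d * (1 - star s * s)) * d.
    rewrite /t1 starB starK starM.
    rewrite !(mulrBl, mulrBr, mul1r, mulr1) !mulrA.
    have -> : star d * star s * star w = star d * d by rewrite -mulrA.
    by rewrite [LHS]addrAC (addrAC (w * star w)).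
  apply: small_nearB; last exact: small_nearMl.
  by apply: small_nearB => //; exact: small_nearMl.
have [q2 [g2 [cg2 g2x tE]]] := local_isometry _ _ t1J.
exists s, (t1 * q2), (fun y => g1 y * g2 y); split.
- exact: continuousM_fun.
- exact: mulf_neq0.
- by rewrite phi_realM // (phi_real_central g1) // -mulrA sE.
- by rewrite phi_realM // -mulrA tE.
(* [star s * t1] is [d - star s * s * d], and [star s * s] acts as 1 under [phi_real g1]. *)
have st1 : phi_real g1 * (star s * t1) = 0.
  rewrite /t1 mulrBr mulrBr (mulrA (star s)) -/d.
  by rewrite (mulrA _ (star s * s)) sE subrr.
rewrite phi_realM // (phi_real_central g1) // -mulrA (mulrA (star s)) (mulrA (phi_real g1)).
by rewrite st1 mul0r mulr0.
Qed.

(** * Isometries over the matrix algebra *)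

(** Inner factors [star t * t] cancel one by one; a leftover power of [t] meets [s] and yields
    [star s * t] or its adjoint. The relations hold only under [c], which centrality moves to the
    middle. *)
Lemma isometry_powers (c s t : A) (j k : nat) :
  (forall a, c * a = a * c) -> star c = c ->
  c * (star s * s) = c -> c * (star t * t) = c -> c * (star s * t) = 0 ->
  c * (star (t ^+ j * s) * (t ^+ k * s)) = (j == k)%:R * c.
Proof.
move=> cC sc cs ct cst.
have cts0 : c * (star t * s) = 0.
  by have := congr1 star cst; rewrite !starM starK sc star0 -cC.
have mid a b d : c * (a * b * d) = a * (c * b) * d by rewrite !mulrA cC.
elim: j k => [|j IH] [|k].
- by rewrite !expr0 !mul1r cs.
- by rewrite expr0 mul1r exprS mul0r -!mulrA (mulrA (star s)) mulrA cst mul0r.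
- rewrite expr0 mul1r exprS mul0r -mulrA starM -mulrA.
  by have := mid (star (t ^+ j * s)) (star t * s) 1; rewrite !mulr1 => ->; rewrite cts0 mulr0.
have -> : star (t ^+ j.+1 * s) * (t ^+ k.+1 * s) =
    star (t ^+ j * s) * (star t * t) * (t ^+ k * s).
  by rewrite !exprS -!(mulrA t) starM !mulrA.
by rewrite mid ct -cC -mulrA IH eqSS.
Qed.

Lemma mxstarM n (M1 M2 : 'M[A]_n) :
  mxstar star (M1 *m M2) = mxstar star M2 *m mxstar star M1.
Proof.
apply/matrixP => i j; rewrite !mxE.
have -> : forall (r : seq 'I_n) (F : 'I_n -> A),
    star (\sum_(k <- r) F k) = \sum_(k <- r) star (F k).
  by move=> r F; exact: (big_morph star starD star0).
by apply: eq_bigr => k _; rewrite !mxE starM.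
Qed.

Lemma mxstarK n : involutive (@mxstar A star n).
Proof. by move=> M; apply/matrixP => i j; rewrite !mxE starK. Qed.

(** The rectangular isometry is cut into two square halves: [W 0] carries the exponents 0 to n and
    [W n.+1] those from n+1 to 2n+1. *)
Lemma matrix_properly_infinite n (c s t : 'I_n.+1 -> A) :
  (forall i a, c i * a = a * c i) -> (forall i, star (c i) = c i) ->
  (forall i, c i * (star (s i) * s i) = c i) ->
  (forall i, c i * (star (t i) * t i) = c i) ->
  (forall i, c i * (star (s i) * t i) = 0) ->
  \sum_i c i * c i = 1 ->
  properly_infinite (@mxstar A star n.+1).
Proof.
move=> cC sc cs ct cst c1.
pose W k : 'M[A]_n.+1 := \matrix_(i, j) (c i * (t i ^+ (k + j) * s i)).
(* Each summand contains [c u] twice; one copy gives access to [isometry_powers], both remain, and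
   [c1] sums them to 1. *)
have WE k l : mxstar star (W k) * W l = \matrix_(i, j) (k + i == l + j)%:R.
  apply/matrixP => i j; rewrite !mxE.
  transitivity (\sum_u (k + i == l + j)%:R * (c u * c u)); last first.
    by rewrite -mulr_sumr c1 mulr1.
  apply: eq_bigr => u _; rewrite !mxE.
  have cc a b : star (c u * a) * (c u * b) = c u * (c u * (star a * b)).
    by rewrite starM sc -cC -!mulrA; congr (_ * _); rewrite !mulrA cC.
  by rewrite cc isometry_powers // mulrA (cC u) -mulrA.
apply: (properly_infinite_isometries _ _ (W 0%N) (W n.+1)).
- exact: mxstarK.
- exact: mxstarM.
- by rewrite WE; apply/matrixP => i j; rewrite !mxE.
- by rewrite WE; apply/matrixP => i j; rewrite !mxE eqn_add2l.
rewrite WE; apply/matrixP => i j; rewrite !mxE.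
by rewrite (ltn_eqF (leq_trans (ltn_ord i) (leq_addr _ _))).
Qed.

(** * Passage to a finite cover *)

Lemma matrix_algebra_properly_infinite : compact [set: X] ->
  (forall x, fibre_properly_infinite star N phi x) ->
  exists n : nat, properly_infinite (@mxstar A star n.+1).
Proof.
move=> cX fibres.
have /choice [D DP] : forall x, exists D : A * A * (X -> R),
    [/\ continuous D.2, D.2 x != 0,
     phi_real D.2 * (star D.1.1 * D.1.1) = phi_real D.2,
     phi_real D.2 * (star D.1.2 * D.1.2) = phi_real D.2 &
     phi_real D.2 * (star D.1.1 * D.1.2) = 0].
  by move=> x; have [s [t [g H]]] := local_isometry_pair _ (fibres x); exists (s, t, g).
pose G x := (D x).2.
have cG x : continuous (G x) by case: (DP x).
have [r rP] : exists r : seq X, forall y, 0 < \sum_(x <- r) G x y * G x y.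
  by apply: compact_sum_sqr_gt0 => // x; case: (DP x).
have [m rE] : exists m, size r = m.+1.
  case: r rP => [|x r] rP; last by exists (size r).
  have : (1 : A) = 0.
    rewrite -phi_real1 -phi_real0; congr phi_real; apply/funext => y.
    by have := rP y; rewrite big_nil ltxx.
  by move/eqP; rewrite oner_eq0.
have [x0 _] : exists x0 : X, True by case: r rE {rP} => // x r _; exists x.
exists m; pose p (i : 'I_m.+1) := nth x0 r i.
pose S y := \sum_(x <- r) G x y * G x y.
pose k y : R := (Num.sqrt (S y))^-1.
have cS : continuous S by apply: continuous_sum_fun => x; exact: continuousM_fun.
have ck : continuous k.
  apply: continuousV_fun => [y|]; first by rewrite gt_eqF // sqrtr_gt0; exact: rP.
  exact: continuous_sqrt_fun.
have ckG x : continuous (fun y => k y * G x y) by exact: continuousM_fun.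
apply: (matrix_properly_infinite m (fun i => phi_real (fun y => k y * G (p i) y))
  (fun i => (D (p i)).1.1) (fun i => (D (p i)).1.2)).
- by move=> i a; exact: phi_real_central.
- by move=> i; exact: phi_real_star.
- by move=> i; rewrite phi_realM // -mulrA; case: (DP (p i)) => _ _ -> _ _.
- by move=> i; rewrite phi_realM // -mulrA; case: (DP (p i)) => _ _ _ -> _.
- by move=> i; rewrite phi_realM // -mulrA; case: (DP (p i)) => _ _ _ _ ->; rewrite mulr0.
have -> : \sum_(i < m.+1) phi_real (fun y => k y * G (p i) y) * phi_real (fun y => k y * G (p i) y)
   = \sum_(i < m.+1) phi_real (fun y => (k y * G (p i) y) * (k y * G (p i) y)).
  by apply: eq_bigr => i _; rewrite (phi_realM _ _ (ckG _) (ckG _)).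
rewrite -phi_real_sum; last by move=> i; exact: continuousM_fun.
rewrite -phi_real1; congr phi_real; apply/funext => y.
transitivity (k y * k y * S y).
  rewrite /S (big_nth x0) rE big_mkord mulr_sumr; apply: eq_bigr => i _.
  by rewrite mulrACA.
have Sy := rP y; rewrite -/(S y) in Sy.
rewrite -invfM -expr2 sqr_sqrtr ?ltW // mulVf // gt_eqF //.
Qed.

End CstarAlgebra.

Theorem theorem2p11 (R : realType) (X : topologicalType)
    (X_compact : compact [set: X]) (X_hausdorff : hausdorff_space X)
    (A : algType R[i]) (star : A -> A) (N : A -> R)
    (A_cstar : is_cstar_algebra star N)
    (phi : (X -> R[i]) -> A) (A_CX : is_CX_structure star phi)
    (fibres_pi : forall x : X, fibre_properly_infinite star N phi x) :
  exists n : nat, properly_infinite (@mxstar A star n.+1).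
Proof. exact: (matrix_algebra_properly_infinite A_cstar A_CX X_compact fibres_pi). Qed.
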